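(* Let $A=\{a_1,\ldots,a_n\}$ be a finite alphabet, $A^*$ the set of finite strings over $A$, $\varepsilon$ the empty string, ${}^\frown$ concatenation, and for a fixed letter $a_k\in A$ let $|\cdot|:A^*\to\{a_k\}^*$ be the tally-length function replacing every letter by $a_k$. Then the structure $(A^*,\varepsilon,a_1,\ldots,a_n,{}^\frown,|\cdot|)$ is $\exists$-interpretable in $\mathcal{T}(\mathcal{L}_{\mathsf{BT}})$.
   Context: Let $\mathbf{H}$ be the set of variable-free terms built from a constant $\perp$ and a binary function symbol $\langle\cdot,\cdot\rangle$. The substitution $t[r\mapsto s]$ is the term obtained by replacing each occurrence of $r$ in $t$ by $s$ (formally: $s$ if $t=r$; $\perp$ if $t\ne r$, $t=\perp$; $\langle t_1[r\mapsto s],t_2[r\mapsto s]\rangle$ if $t\ne r$, $t=\langle t_1,t_2\rangle$). $\mathcal{T}(\mathcal{L}_{\mathsf{BT}})=(\mathbf{H},\perp,\langle\cdot,\cdot\rangle,\cdot[\cdot\mapsto\cdot])$ (term algebra plus substitution). An existential formula is one built from atomic formulas and their negations using $\wedge,\vee$ and unbounded $\exists$. A structure $\mathfrak A$ in a finite language $\mathcal{L}_0$ is $\exists$-interpretable in a structure $\mathfrak B$ in a finite language $\mathcal{L}_1$ if there are parameter-free existential $\mathcal{L}_1$-formulas: $\delta(x)$ defining a nonempty subset $A'$ of the universe of $\mathfrak B$; for each constant $c$ of $\mathcal{L}_0$ a formula $\phi_c(x)$ defining a unique element of $A'$; for each $n$-ary function symbol $f$ a formula $\phi_f(x_1,\ldots,x_n,y)$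 defining a function $(A')^n\to A'$; for each $n$-ary relation symbol $R$ formulas $\phi_R$, $\phi_{R^c}$ defining disjoint sets whose union is $(A')^n$; such that the resulting $\mathcal{L}_0$-structure on $A'$ is isomorphic to $\mathfrak A$ (equality is interpreted as equality). *)

(* Defs.v *)
From HB Require Import structures.
From mathcomp Require Import all_boot.

Set Implicit Arguments.
Unset Strict Implicit.
Unset Printing Implicit Defensive.

(** * Finite first-order languages and their structures *)

Record language := Language {
  csym : finType;
  fsym : finType;
  far : fsym -> nat;
  rsym : finType;
  rar : rsym -> nat }.

Record structure (L : language) (T : Type) := Structure {
  icst : csym L -> T;
  ifun : forall f : fsym L, {ffun 'I_(far f) -> T} -> T;
  irel : forall r : rsym L, {ffun 'I_(rar r) -> T} -> Prop }.

Definition isomorphic (L : language) (T U : Type)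
    (M : structure L T) (N : structure L U) : Prop :=
  exists h : T -> U,
    [/\ bijective h,
        forall c, h (icst M c) = icst N c,
        forall f (v : {ffun 'I_(far f) -> T}),
          h (ifun M v) = ifun N [ffun i => h (v i)]
      & forall r (v : {ffun 'I_(rar r) -> T}),
          irel M v <-> irel N [ffun i => h (v i)]].

(** * Existential formulas *)

(* [term L n] and [eform L n]: variables are numbered 0, ..., n-1, so that
   [eform L 0] is the type of existential sentences. *)
Inductive term (L : language) (n : nat) : Type :=
| TVar of 'I_n
| TCst of csym L
| TApp (f : fsym L) of {ffun 'I_(far f) -> term L n}.

(* The variable bound by [EEx] in [EEx p : eform L n] is number n in [p]
   (de Bruijn levels). *)
Inductive eform (L : language) (n : nat) : Type :=
| EEq of term L n & term L n
| ENeq of term L n & term L n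
| ERel (r : rsym L) of {ffun 'I_(rar r) -> term L n}
| ENrel (r : rsym L) of {ffun 'I_(rar r) -> term L n}
| EAnd of eform L n & eform L n
| EOr of eform L n & eform L n
| EEx of eform L n.+1.

Definition ext (T : Type) (n : nat) (v : {ffun 'I_n -> T}) (y : T) :
    {ffun 'I_n.+1 -> T} :=
  [ffun i => if unlift ord_max i is Some j then v j else y].

Fixpoint eval (L : language) (T : Type) (M : structure L T) (n : nat)
    (v : {ffun 'I_n -> T}) (t : term L n) : T :=
  match t with
  | TVar i => v i
  | TCst c => icst M c
  | TApp f a => ifun M [ffun i => eval M v (a i)]
  end.

Fixpoint sat (L : language) (T : Type) (M : structure L T) (n : nat)
    (v : {ffun 'I_n -> T}) (p : eform L n) : Prop :=
  match p with
  | EEq t u => eval M v t = eval M v u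
  | ENeq t u => eval M v t <> eval M v u
  | ERel r a => irel M [ffun i => eval M v (a i)]
  | ENrel r a => ~ irel M [ffun i => eval M v (a i)]
  | EAnd p q => sat M v p /\ sat M v q
  | EOr p q => sat M v p \/ sat M v q
  | EEx p => exists y : T, sat M (ext v y) p
  end.

Definition sat1 (L : language) (T : Type) (M : structure L T)
    (p : eform L 1) (x : T) : Prop :=
  sat M [ffun=> x] p.

(** * Existential interpretations *)

(* [ifor_f f] is phi_f(x_1, ..., x_n, y), with y the last variable. *)
Record interpretation (L0 L1 : language) := Interpretation {
  ifor_dom : eform L1 1;
  ifor_c : csym L0 -> eform L1 1;
  ifor_f : forall f : fsym L0, eform L1 (far f).+1;
  ifor_r : forall r : rsym L0, eform L1 (rar r);
  ifor_rc : forall r : rsym L0, eform L1 (rar r) }.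

Definition idom (L0 L1 : language) (T : Type) (B : structure L1 T)
    (I : interpretation L0 L1) : Type :=
  {x : T | sat1 B (ifor_dom I) x}.

(* The formulas of [I] define in [B] the structure [S] on the definable set
   [idom B I]: as subsets of powers of the whole universe, they define
   exactly the singletons, the graphs of the functions, and the relations
   of [S] together with their complements relative to [idom B I]. *)
Definition defines_structure (L0 L1 : language) (T : Type)
    (B : structure L1 T) (I : interpretation L0 L1)
    (S : structure L0 (idom B I)) : Prop :=
  [/\ forall c x, sat1 B (ifor_c I c) x <-> x = sval (icst S c),
      forall f (v : {ffun 'I_(far f) -> T}) (y : T),
        sat B (ext v y) (ifor_f I f) <->
        exists w : {ffun 'I_(far f) -> idom B I},
          v = [ffun i => sval (w i)] /\ y = sval (ifun S w),
      forall r (v : {ffun 'I_(rar r) -> T}),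
        sat B v (ifor_r I r) <->
        exists w : {ffun 'I_(rar r) -> idom B I},
          v = [ffun i => sval (w i)] /\ irel S w
    & forall r (v : {ffun 'I_(rar r) -> T}),
        sat B v (ifor_rc I r) <->
        exists w : {ffun 'I_(rar r) -> idom B I},
          v = [ffun i => sval (w i)] /\ ~ irel S w].

Definition exists_interpretable (L0 L1 : language) (T0 T1 : Type)
    (A : structure L0 T0) (B : structure L1 T1) : Prop :=
  exists I : interpretation L0 L1,
    (exists x : T1, sat1 B (ifor_dom I) x) /\
    exists S : structure L0 (idom B I),
      defines_structure S /\ isomorphic S A.

(** * Binary trees with substitution *)

Inductive btree : Type := Bot | Pair of btree & btree.

Definition btree_eq_dec : comparable btree.
Proof. by move=> x y; rewrite /decidable; decide equality. Defined.

HB.instance Definition _ := hasDecEq.Build btree (compareP btree_eq_dec).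

(* t[r |-> s] *)
Fixpoint bsubst (t r s : btree) : btree :=
  if t == r then s else
  match t with
  | Bot => Bot
  | Pair t1 t2 => Pair (bsubst t1 r s) (bsubst t2 r s)
  end.

Inductive bt_fsym : Type := FPair | FSubst.

Definition bt_fsym_bool (f : bt_fsym) : bool :=
  if f is FPair then true else false.
Definition bool_bt_fsym (b : bool) : bt_fsym := if b then FPair else FSubst.
Lemma bt_fsym_boolK : cancel bt_fsym_bool bool_bt_fsym.
Proof. by case. Qed.
HB.instance Definition _ := Finite.copy bt_fsym (can_type bt_fsym_boolK).

Definition bt_far (f : bt_fsym) : nat :=
  match f with FPair => 2 | FSubst => 3 end.

Definition L_BT : language :=
  @Language unit bt_fsym bt_far void (fun _ => 0).

Definition bt_fun (f : bt_fsym) : {ffun 'I_(bt_far f) -> btree} -> btree :=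
  match f with
  | FPair => fun v => Pair (v (@Ordinal 2 0 isT)) (v (@Ordinal 2 1 isT))
  | FSubst => fun v => bsubst (v (@Ordinal 3 0 isT)) (v (@Ordinal 3 1 isT))
                              (v (@Ordinal 3 2 isT))
  end.

Definition T_BT : structure L_BT btree :=
  @Structure L_BT btree (fun _ => Bot) bt_fun (fun r _ => match r with end).

(** * Strings with concatenation and tally length *)

Inductive str_fsym : Type := FConcat | FTally.

Definition str_fsym_bool (f : str_fsym) : bool :=
  if f is FConcat then true else false.
Definition bool_str_fsym (b : bool) : str_fsym :=
  if b then FConcat else FTally.
Lemma str_fsym_boolK : cancel str_fsym_bool bool_str_fsym.
Proof. by case. Qed.
HB.instance Definition _ := Finite.copy str_fsym (can_type str_fsym_boolK).

Definition str_far (f : str_fsym) : nat :=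
  match f with FConcat => 2 | FTally => 1 end.

(* The constant symbol [None] names the empty string and [Some a] names the
   one-letter string a. *)
Definition L_str (A : finType) : language :=
  @Language (option A) str_fsym str_far void (fun _ => 0).

Definition tally (A : Type) (ak : A) (w : seq A) : seq A := [seq ak | _ <- w].

Definition str_cst (A : Type) (c : option A) : seq A :=
  if c is Some a then [:: a] else [::].

Definition str_fun (A : Type) (ak : A) (f : str_fsym) :
    {ffun 'I_(str_far f) -> seq A} -> seq A :=
  match f with
  | FConcat => fun v => v (@Ordinal 2 0 isT) ++ v (@Ordinal 2 1 isT)
  | FTally => fun v => tally ak (v (@Ordinal 1 0 isT))
  end.

Definition string_structure (A : finType) (ak : A) :
    structure (L_str A) (seq A) :=
  @Structure (L_str A) (seq A) (@str_cst A) (@str_fun A ak)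
    (fun r _ => match r with end).

(* Main.v *)
From Stdlib Require Import Setoid.
Require Import Defs.
From mathcomp Require Import all_boot.

(** Choose pairwise distinct trees of equal size, one code [c_a] for each
    letter and one for the empty string; no code is a proper subterm of another.
    Encode a string as the right comb
    [<c_a1, <c_a2, ..., <c_am, code None>...>>].  Concatenation is then the
    substitution [u[code None |-> v]], and the tally length is the composition
    of the substitutions [c_a |-> c_ak].  A tree [t] encodes a power of [ak] iff
    [t[code None |-> <c_ak, code None>] = <c_ak, t>], and it encodes a string
    iff its tally image encodes a power of [ak]; hence even quantifier-free
    formulas suffice. *)

Set Implicit Arguments.
Unset Strict Implicit.
Unset Printing Implicit Defensive.

(** * Tree size and its effect on substitution *)

Fixpoint bsize (t : btree) : nat :=
  if t is Pair t1 t2 then (bsize t1 + bsize t2).+1 else 0.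

Lemma bsize_Pair t1 t2 : bsize (Pair t1 t2) = (bsize t1 + bsize t2).+1.
Proof. by []. Qed.

Lemma bsubstE t1 t2 r s : bsubst (Pair t1 t2) r s =
  if Pair t1 t2 == r then s else Pair (bsubst t1 r s) (bsubst t2 r s).
Proof. by []. Qed.

Lemma bsubst_root r s : bsubst r r s = s.
Proof. by case: r => [|r1 r2] //; rewrite bsubstE eqxx. Qed.

(** Every proper subterm of [t] is strictly smaller than [t], hence than [r], so [r] does not occur
    in [t]. *)
Lemma bsubst_id t r s : bsize t <= bsize r -> t != r -> bsubst t r s = t.
Proof.
elim: t => [|t1 IH1 t2 IH2] le_tr neq_tr; first by rewrite /= (negPf neq_tr).
have [lt1 lt2]: bsize t1 < bsize r /\ bsize t2 < bsize r.
  by split; apply: leq_trans le_tr; rewrite ltnS ?leq_addr ?leq_addl.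
have small t : bsize t < bsize r -> t != r.
  by apply: contraTneq => ->; rewrite ltnn.
by rewrite bsubstE (negPf neq_tr) IH1 ?IH2 // ?small // ltnW.
Qed.

Lemma leq_bsize_bsubst t r s :
  bsize r <= bsize s -> bsize t <= bsize (bsubst t r s).
Proof.
move=> le_rs; elim: t => [|t1 IH1 t2 IH2] //; rewrite bsubstE.
by case: eqP => [->|_] //=; rewrite ltnS leq_add.
Qed.

(** If [t] is not [r], then [t] is no larger than its image [u], hence no larger than [r], so the
    substitution leaves it fixed. *)
Lemma bsubst_inv t r s u : bsize r <= bsize s -> bsize u <= bsize r ->
  bsubst t r s = u -> t = u \/ t = r /\ u = s.
Proof.
move=> le_rs le_ur def_u.
have [def_t|neq_tr] := eqVneq t r.
  by right; rewrite -def_u def_t bsubst_root.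
left; rewrite -def_u bsubst_id //; apply: leq_trans le_ur.
by rewrite -def_u leq_bsize_bsubst.
Qed.

Definition comb (n : nat) : btree := iter n (fun t => Pair t Bot) Bot.

Lemma bsize_comb n : bsize (comb n) = n.
Proof. by elim: n => //= n ->; rewrite addn0. Qed.

(** * Codes of letters and of the empty string *)

Section StringCodes.

Variables (A : finType) (ak : A).

(** The two comb sizes add up to the cardinal of [option A], so all codes have equal size, while the
    size of the first comb recovers the rank of [x]. *)
Definition code (x : option A) : btree :=
  Pair (comb (enum_rank x)) (comb (#|{: option A}| - enum_rank x)).

Lemma bsize_code x : bsize (code x) = #|{: option A}|.+1.
Proof. by rewrite /= !bsize_comb subnKC // ltnW. Qed.

Lemma code_inj : injective code.
Proof.
move=> x y [/(congr1 bsize)]; rewrite !bsize_comb => /val_inj.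
by move/enum_rank_inj.
Qed.

Lemma Pair_code_neq x y t : (Pair (code x) t == code y) = false.
Proof.
apply/eqP => /(congr1 bsize); rewrite bsize_Pair !bsize_code.
by move/eqP; rewrite eqSS gtn_eqF ?leq_addr.
Qed.

Lemma code_Pair_neq x y t : code y <> Pair (code x) t.
Proof. by move/esym/eqP; rewrite Pair_code_neq. Qed.

Lemma bsubst_code x y s :
  bsubst (code x) (code y) s = if x == y then s else code x.
Proof.
case: eqP => [->|neq_xy]; first exact: bsubst_root.
by rewrite bsubst_id ?bsize_code //; apply/eqP => /code_inj.
Qed.

Lemma bsubst_Pair_code x y t s : bsubst (Pair (code x) t) (code y) s =
  Pair (if x == y then s else code x) (bsubst t (code y) s).
Proof. by rewrite bsubstE Pair_code_neq bsubst_code. Qed.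

Lemma bsubst_code_inv t x y z : bsubst t (code x) (code y) = code z ->
  t = code z \/ t = code x /\ z = y.
Proof.
move=> /bsubst_inv; rewrite !bsize_code => /(_ (leqnn _) (leqnn _)).
by case=> [|[-> /code_inj]]; auto.
Qed.

(** * Strings as right combs *)

Definition enc (w : seq A) : btree :=
  foldr (fun a t => Pair (code (Some a)) t) (code None) w.

Lemma enc_inj : injective enc.
Proof.
elim=> [|a u IH] [|b v] //=.
- by move/code_Pair_neq.
- by move/esym/code_Pair_neq.
- by case=> /(congr1 bsize); rewrite !bsize_comb => /val_inj /enum_rank_inj
    [->] _ /IH ->.
Qed.

(** [code None] occurs in [enc u] only at the end of the spine: no letter code contains it, and by
    size no [Pair (code x) t] equals it. *)
Lemma enc_cat u v : enc (u ++ v) = bsubst (enc u) (code None) (enc v).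
Proof.
elim: u => [|a u IH]; first by rewrite [enc _]/= bsubst_root.
by rewrite [enc (a :: u)]/= bsubst_Pair_code -IH.
Qed.

Lemma bsubst_letter w a b :
  bsubst (enc w) (code (Some a)) (code (Some b)) =
  enc [seq if x == a then b else x | x <- w].
Proof.
elim: w => [|x w IH]; first by rewrite [LHS]bsubst_code.
rewrite [enc (x :: w)]/= bsubst_Pair_code IH /=.
by rewrite (inj_eq Some_inj); case: eqP.
Qed.

(** Along the spine, each first component of [t] is either the letter code seen in the image or the
    code of [a], so [t] is already a comb of letter codes. *)
Lemma bsubst_letter_inv t a b w :
  bsubst t (code (Some a)) (code (Some b)) = enc w -> exists w', t = enc w'.
Proof.
elim: w t => [|x w IH] t.
  by case/bsubst_code_inv => [->|[]] //; exists [::].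
case: t => [|t1 t2] //; rewrite bsubstE.
case: eqP => [_ /code_Pair_neq //|_ [/bsubst_code_inv def_t1 /IH[w' ->]]].
by case: def_t1 => [->|[-> _]]; [exists (x :: w') | exists (a :: w')].
Qed.

(** * Tally length by iterated substitution, and recognition of strings *)

Definition tally_subst (s : seq A) (t : btree) : btree :=
  foldl (fun t a => bsubst t (code (Some a)) (code (Some ak))) t s.

Lemma tally_subst_enc w : tally_subst (enum A) (enc w) = enc (Defs.tally ak w).
Proof.
(* After the letters of [s] are processed, exactly these have become [ak]; a letter already turned
   into [ak] stays so, since a later step on [ak] sends it to itself. *)
have gen s u : tally_subst s (enc u) =
    enc [seq if x \in s then ak else x | x <- u].
  elim: s u => [|a s IH] u; first by rewrite map_id.
  rewrite /= bsubst_letter IH -map_comp; congr enc; apply: eq_map => x /=.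
  by rewrite in_cons; case: eqP => //= _; case: ifP.
by rewrite gen; congr enc; apply: eq_map => x; rewrite mem_enum.
Qed.

Lemma tally_subst_inv s t w : tally_subst s t = enc w -> exists u, t = enc u.
Proof.
elim: s t => [|a s IH] t /=; first by exists w.
by case/IH=> u; apply: bsubst_letter_inv.
Qed.

(* This is the equation [ak u = u ak] on strings. *)
Definition is_power (t : btree) : Prop :=
  bsubst t (code None) (Pair (code (Some ak)) (code None)) =
  Pair (code (Some ak)) t.

(** The equation passes to the right component: the left one must be the code of [ak], as the other
    alternative of [bsubst_inv] equates a code with a larger tree. *)
Lemma is_power_enc t : is_power t -> exists w, t = enc w.
Proof.
rewrite /is_power; elim: t => [|t1 IH1 t2 IH2] //; rewrite bsubstE.
case: eqP => [-> _|_ [def_t1 def_t2]]; first by exists [::].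
have {def_t1} /bsubst_inv[||def_t1|[_ /code_Pair_neq]] // := def_t1.
- by rewrite bsize_Pair !bsize_code leqW // leq_addl.
- by rewrite !bsize_code.
by move: def_t2; rewrite def_t1 => /IH2[w ->]; exists (ak :: w).
Qed.

Lemma is_power_tally w : is_power (enc (Defs.tally ak w)).
Proof.
rewrite /is_power -[Pair _ (code None)]/(enc [:: ak]) -enc_cat.
rewrite -[RHS]/(enc (ak :: Defs.tally ak w)); congr enc.
by elim: w => //= _ w ->.
Qed.

Lemma is_power_tally_subst t :
  is_power (tally_subst (enum A) t) <-> exists w, t = enc w.
Proof.
split=> [/is_power_enc[w /tally_subst_inv] //|[w ->]].
by rewrite tally_subst_enc; apply: is_power_tally.
Qed.

(** * Terms and formulas expressing these operations *)

Definition t_pair n (t u : term L_BT n) : term L_BT n :=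
  @TApp L_BT n FPair [ffun i : 'I_2 => if val i == 0 then t else u].

Definition t_subst n (t r s : term L_BT n) : term L_BT n :=
  @TApp L_BT n FSubst [ffun i : 'I_3 => nth t [:: t; r; s] i].

(** Every tree is the value of a closed term, so codes may appear in parameter-free formulas. *)
Fixpoint t_tree n (t : btree) : term L_BT n :=
  if t is Pair t1 t2 then t_pair (t_tree n t1) (t_tree n t2)
  else @TCst L_BT n tt.

Definition t_tally n (s : seq A) (t : term L_BT n) : term L_BT n :=
  foldl (fun t a =>
    t_subst t (t_tree n (code (Some a))) (t_tree n (code (Some ak)))) t s.

Definition f_string n (t : term L_BT n) : eform L_BT n :=
  let u := t_tally (enum A) t in
  EEq (t_subst u (t_tree n (code None))
         (t_tree n (Pair (code (Some ak)) (code None))))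
      (t_pair (t_tree n (code (Some ak))) u).

Section Evaluation.

Variables (n : nat) (v : {ffun 'I_n -> btree}).

Lemma eval_pair t u :
  eval T_BT v (t_pair t u) = Pair (eval T_BT v t) (eval T_BT v u).
Proof. by rewrite /= !ffunE. Qed.

Lemma eval_subst t r s : eval T_BT v (t_subst t r s) =
  bsubst (eval T_BT v t) (eval T_BT v r) (eval T_BT v s).
Proof. by rewrite /= !ffunE. Qed.

Lemma eval_tree t : eval T_BT v (t_tree n t) = t.
Proof.
by elim: t => [|t1 IH1 t2 IH2] //; rewrite [t_tree _ _]/= eval_pair IH1 IH2.
Qed.

Lemma eval_tally s t :
  eval T_BT v (t_tally s t) = tally_subst s (eval T_BT v t).
Proof.
by elim: s t => [|a s IH] t //; rewrite [LHS]IH eval_subst !eval_tree.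
Qed.

Lemma sat_string t :
  sat T_BT v (f_string t) <-> exists w, eval T_BT v t = enc w.
Proof.
rewrite -is_power_tally_subst /f_string [X in X <-> _]/sat.
by rewrite eval_subst eval_pair !eval_tree eval_tally.
Qed.

Lemma sat_all m (F : 'I_m -> eform L_BT n) p :
  sat T_BT v (foldr (fun i => EAnd (F i)) p (enum 'I_m)) <->
  (forall i, sat T_BT v (F i)) /\ sat T_BT v p.
Proof.
(* The induction runs over an arbitrary list of indices in place of [enum 'I_m]. *)
have gen s : sat T_BT v (foldr (fun i => EAnd (F i)) p s) <->
    {in s, forall i, sat T_BT v (F i)} /\ sat T_BT v p.
  elim: s => [|i s IH] /=; first by split=> [|[]].
  rewrite IH; split=> [[Fi [Fs]]|[Fs ?]].
    by split=> // j; rewrite in_cons => /predU1P[->|/Fs].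
  split; first exact/Fs/mem_head.
  by split=> // j s_j; apply: (Fs j); rewrite in_cons s_j orbT.
rewrite gen; split=> [[Fs ?]|[Fs ?]]; split=> // i.
by apply: (Fs i); rewrite mem_enum.
Qed.

Definition t_fun (f : str_fsym) :
    ('I_(str_far f) -> term L_BT n) -> term L_BT n :=
  match f with
  | FConcat => fun x => t_subst (x (@Ordinal 2 0 isT)) (t_tree n (code None))
                                (x (@Ordinal 2 1 isT))
  | FTally => fun x => t_tally (enum A) (x (@Ordinal 1 0 isT))
  end.

Lemma eval_fun f (x : 'I_(str_far f) -> term L_BT n)
    (w : {ffun 'I_(str_far f) -> seq A}) :
  (forall i, eval T_BT v (x i) = enc (w i)) ->
  eval T_BT v (t_fun x) = enc (str_fun ak w).
Proof.
case: f x w => x w def_x; rewrite /t_fun /str_fun.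
  by rewrite eval_subst eval_tree !def_x enc_cat.
by rewrite eval_tally def_x tally_subst_enc.
Qed.

End Evaluation.

(** * The interpretation and the structure it defines *)

(** Argument [i] is the variable [lift ord_max i] and the value is [ord_max], as in [ext]. The
    string conditions confine the graph to the domain, since substitution is total on trees. *)
Definition f_fun (f : str_fsym) : eform L_BT (str_far f).+1 :=
  foldr (fun i => EAnd (f_string (@TVar L_BT _ (lift ord_max i))))
    (EEq (@TVar L_BT _ ord_max) (t_fun (fun i => @TVar L_BT _ (lift ord_max i))))
    (enum 'I_(str_far f)).

Definition str_interpretation : interpretation (L_str A) L_BT :=
  @Interpretation (L_str A) L_BT
    (f_string (@TVar L_BT 1 ord0))
    (fun c => EEq (@TVar L_BT 1 ord0) (t_tree 1 (enc (str_cst c))))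
    f_fun
    (fun r => match r with end) (fun r => match r with end).

Let dom := idom T_BT str_interpretation.

Lemma sat1_string x : sat1 T_BT (ifor_dom str_interpretation) x <->
  exists w, x = enc w.
Proof. by rewrite /sat1 sat_string /= ffunE. Qed.

(** The domain formula is an equation, so a membership proof is an equality proof in a type with
    decidable equality, and such proofs are unique. *)
Lemma dom_val_inj : injective (fun x : dom => sval x).
Proof.
case=> x Dx [y Dy] /= eq_xy; case: y / eq_xy Dy => Dy.
by congr exist; apply: eq_irrelevance.
Qed.

Definition to_dom (w : seq A) : dom :=
  exist _ (enc w) (proj2 (sat1_string _) (ex_intro _ w erefl)).

(** The equality is boolean so that [xchoose] can extract a string; injectivity of [enc] makes it
    the only one. *)
Lemma dom_ex (x : dom) : exists w, enc w == sval x.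
Proof.
by have [w def_x] := proj1 (sat1_string _) (proj2_sig x); exists w; apply/eqP.
Qed.

Definition of_dom (x : dom) : seq A := xchoose (dom_ex x).

Lemma enc_of_dom x : enc (of_dom x) = sval x.
Proof. exact/eqP/(xchooseP (dom_ex x)). Qed.

Lemma of_domK : cancel of_dom to_dom.
Proof. by move=> x; apply: dom_val_inj; apply: enc_of_dom. Qed.

Lemma to_domK : cancel to_dom of_dom.
Proof. by move=> w; apply: enc_inj; apply: enc_of_dom. Qed.

Definition dom_structure : structure (L_str A) dom :=
  @Structure (L_str A) dom (fun c => to_dom (str_cst c))
    (fun f w => to_dom (str_fun ak [ffun i => of_dom (w i)]))
    (fun r _ => match r with end).

Lemma dom_structure_iso : isomorphic dom_structure (string_structure ak).
Proof.
exists of_dom; split=> [|c|f v|[]]; [|exact: to_domK|exact: to_domK].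
by exists to_dom; [apply: of_domK | apply: to_domK].
Qed.

Lemma ext_max (T : Type) n (v : {ffun 'I_n -> T}) y : ext v y ord_max = y.
Proof. by rewrite ffunE unlift_none. Qed.

Lemma ext_lift (T : Type) n (v : {ffun 'I_n -> T}) y i :
  ext v y (lift ord_max i) = v i.
Proof. by rewrite ffunE liftK. Qed.

Lemma sat_f_fun f (v : {ffun 'I_(str_far f) -> btree}) y :
  sat T_BT (ext v y) (f_fun f) <->
  exists w : {ffun 'I_(str_far f) -> dom},
    v = [ffun i => sval (w i)] /\ y = sval (ifun dom_structure w).
Proof.
rewrite /f_fun sat_all.
have eval_f (w : {ffun 'I_(str_far f) -> dom}) : v = [ffun i => sval (w i)] ->
    eval T_BT (ext v y) (t_fun (fun i => @TVar L_BT _ (lift ord_max i))) =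
    sval (ifun dom_structure w).
  move=> def_v; apply: eval_fun => i.
  by rewrite /= ext_lift def_v !ffunE enc_of_dom.
split=> [[Dv]|[w [def_v def_y]]].
  (* The string conditions provide the membership proofs that lift [v] to a tuple [w] of domain
     elements. *)
  have {}Dv i : sat1 T_BT (ifor_dom str_interpretation) (v i).
    by apply/sat1_string; have := Dv i; rewrite sat_string /= ext_lift.
  pose w : {ffun 'I_(str_far f) -> dom} := [ffun i => exist _ (v i) (Dv i)].
  have def_v : v = [ffun i => sval (w i)].
    by apply/ffunP => i; rewrite !ffunE.
  rewrite /sat (eval_f w) // [eval _ _ _]/= ext_max => def_y.
  by exists w.
split=> [i|]; last by rewrite /sat (eval_f w) // [LHS]/= ext_max.
apply/sat_string; exists (of_dom (w i)).
by rewrite /= ext_lift def_v ffunE enc_of_dom.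
Qed.

End StringCodes.

Theorem theorem4 (A : finType) (ak : A) :
  exists_interpretable (string_structure ak) T_BT.
Proof.
exists (str_interpretation ak); split.
  (* The code of the empty string shows that the domain is nonempty. *)
  by exists (enc (Nil A)); apply/sat1_string; exists [::].
exists (dom_structure ak); split; last exact: dom_structure_iso.
split=> [c x|f v y|[]|[]]; last exact: sat_f_fun.
by rewrite /sat1 [X in X <-> _]/= eval_tree ffunE.
Qed.
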